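(* Let $R=k[x_0,\ldots,x_n]$ be a polynomial ring over a field $k$ of any characteristic, let $1\le c<s$ be integers, and let $\mathcal F=\{F_1,\ldots,F_s\}$ be a set of $s$ forms in $R$ such that any $c+1$ of them form a regular sequence. Let $I_c=\bigcap_{1\le j_1<\cdots<j_c\le s}(F_{j_1},\ldots,F_{j_c})$. For any monomial $M$ in $\mathcal F$ one has $$\mathrm{Sdeg}_c(M)=\max\{u \mid M\in I_c^{(u)}\}=\text{ the integer } m \text{ with } M\in I_c^{(m)}\setminus I_c^{(m+1)}.$$
   Context: For a homogeneous ideal $I\subseteq R$ and $m\ge 1$, the symbolic power is $I^{(m)}=\bigcap_{P\in \mathrm{Ass}(R/I)}(I^mR_P\cap R)$; by convention $I^{(0)}=R$. A monomial in $\mathcal F$ is a product (possibly with repetition) of elements of $\mathcal F$. Under the stated hypothesis on $\mathcal F$, every monomial $M$ in $\mathcal F$ is a product of elements of $\mathcal F$ in only one way up to order; $\mathrm{supp}(M)\subseteq\mathcal F$ is the set of elements occurring in it, and $M$ is squarefree if it is a product of distinct elements of $\mathcal F$. Every monomial $M$ has a unique normal form $M=M^{(1)}\cdots M^{(t)}$, where the $M^{(j)}$ are squarefree monomials in $\mathcal F$ with $\emptyset\ne\mathrm{supp}(M^{(i+1)})\subseteq\mathrm{supp}(M^{(i)})$ for all $1\le i\le t-1$. The symbolic degree of $M$ is $\mathrm{Sdeg}_c(M)=\sum_{i=1}^t\max\{0,\,c-s+|\mathrm{supp}(M^{(i)})|\}$. *)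

(* Defs.v *)
From HB Require Import structures.
From mathcomp Require Import all_boot all_order all_algebra.
From mathcomp Require Import boolp classical_sets.
From mathcomp Require Export mpoly.

Set Implicit Arguments.
Unset Strict Implicit.
Unset Printing Implicit Defensive.

Import GRing.Theory.

Local Open Scope classical_set_scope.
Local Open Scope ring_scope.

(* Finite sums of products a * g with a in A and g in G: the A-submodule
   generated by G, when A is a subring. *)
Definition span_over (S : comNzRingType) (A G : set S) : set S :=
  [set x | exists l : seq (S * S),
     (forall p, p \in l -> A p.1 /\ G p.2) /\ x = \sum_(p <- l) p.1 * p.2].

Definition ideal_gen (R : comNzRingType) (G : set R) : set R :=
  span_over setT G.

(* The empty product makes ideal_pow I 0 the unit ideal. *)
Definition ideal_pow (R : comNzRingType) (I : set R) (m : nat) : set R :=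
  ideal_gen [set x | exists f : 'I_m -> R,
                       (forall i, I (f i)) /\ x = \prod_(i < m) f i].

(* [idealr_closed] includes that 1 is not in P. *)
Definition prime_ideal (R : comNzRingType) (P : set R) : Prop :=
  idealr_closed (mem P) /\ prime_idealr_closed (mem P).

(* P belongs to Ass(R/I): P is prime and is the annihilator
   {r | r * x in I} of the class in R/I of some x in R. *)
Definition associated_prime (R : comNzRingType) (I P : set R) : Prop :=
  prime_ideal P /\ exists x, P = [set r | I (r * x)].

(* R_P, as a subring of the fraction field of the domain R. *)
Definition localization (R : idomainType) (P : set R) : set {fraction R} :=
  [set z | exists a b, ~ P b /\ z = tofrac a / tofrac b].

(* J R_P \cap R. *)
Definition loc_contraction (R : idomainType) (J P : set R) : set R :=
  @tofrac R @^-1` span_over (localization P) (@tofrac R @` J).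

Definition symbolic_pow (R : idomainType) (I : set R) (m : nat) : set R :=
  if m is 0 then setT
  else \bigcap_(P in associated_prime I) loc_contraction (ideal_pow I m) P.

Definition regular_sequence (R : comNzRingType) (fs : seq R) : Prop :=
  (forall i x, (i < size fs)%N ->
     ideal_gen [set` take i fs] (nth 0 fs i * x) ->
     ideal_gen [set` take i fs] x) /\
  ~ ideal_gen [set` fs] 1.

Section Family.
Variables (R : idomainType) (s : nat) (F : 'I_s -> R).

Definition star_ideal (c : nat) : set R :=
  \bigcap_(A in [set A : {set 'I_s} | #|A| = c]) ideal_gen (F @` [set` A]).

Definition monomial_in (M : R) : Prop :=
  exists J : seq 'I_s, M = \prod_(j <- J) F j.

(* A squarefree monomial in F is encoded by its support, a set of indices;
   a normal form M^(1) ... M^(t) by the sequence of its supports. *)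
Definition normal_form (M : R) (L : seq {set 'I_s}) : Prop :=
  [/\ forall A, A \in L -> A != finset.set0,
      forall i, (i.+1 < size L)%N ->
        nth finset.set0 L i.+1 \subset nth finset.set0 L i
    & M = \prod_(A <- L) \prod_(j in A) F j].

(* The normal form chosen by [xget] is the only one when any two distinct F i,
   F j form a regular sequence (unique factorization in R = k[x_0..x_n]: they
   are coprime nonunits).
   The truncated subtraction of nat makes each
   summand max{0, c - s + |A|}. *)
Definition Sdeg (c : nat) (M : R) : nat :=
  (\sum_(A <- xget [::] (normal_form M)) (c + #|A| - s))%N.

End Family.

Definition is_max (P : set nat) (m : nat) : Prop :=
  P m /\ forall u, P u -> (u <= m)%N.

(* Main.v *)
Require Import Defs.
From mathcomp Require Import all_boot all_order all_algebra.
From mathcomp Require Import boolp classical_sets.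
From mathcomp Require Import ring zify.

Import GRing.Theory.

(** Write the monomial as M = prod_j F_j^(a_j), and for a set A of c indices
    let F_A be the ideal generated by the F_j with j in A, so that I_c is the
    intersection of the F_A. Everything rests on the equivalence

      M lies in I_c^(m)   iff   m <= sum_(j in A) a_j for all A with |A| = c.

    Each associated prime P of I_c comes from such a set A: writing
    P = (I_c : x), some F_A misses x, and F_i is a nonzerodivisor modulo F_A
    for i outside A, hence F_i is not in P ([associated_star]). After
    localizing at P the factors F_i with i outside A become units, while F_j
    times the product of those units is in I_c for j in A; so the condition
    on the exponents over A gives M in I_c^m R_P
    ([monomial_loc_contraction]).

    Conversely every A occurs: a polynomial ring is noetherian (via Dickson's
    lemma and leading monomials, [mpoly_noetherian]), so R/F_A has an
    associated prime (F_A : x), and it equals (I_c : x prod_(i notin A) F_i)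
    ([exists_associated_star]). If M is in I_c^m R_P for that P, then
    u prod_(j in A) F_j^(a_j) is in (F_A)^m for some u outside P. A regular
    sequence is quasi-regular, so when m > sum_(j in A) a_j this forces u to
    be in F_A, which is contained in P, a contradiction
    ([adjoin_pow_monomial], [loc_contraction_monomial]).

    It remains to see that Sdeg_c(M) is the minimum of sum_(j in A) a_j over
    the sets A with c elements. If A_1, ..., A_t are the supports in a normal
    form, this sum is sum_l |A_l :&: A|, and each term is at least
    c + |A_l| - s. Since the supports form a chain, a set A with the least
    exponent sum attains equality in every term ([sum_defects_attained]). *)

Local Open Scope ring_scope.

(** * Powers of an ideal generated by a regular sequence *)

Section PowersOfIdeals.
Set Implicit Arguments.
Unset Strict Implicit.
Local Open Scope classical_set_scope.
Variable R : comNzRingType.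
Implicit Types (K : set R) (f g x y : R) (fs gs : seq R).

Definition is_ideal K := K 0 /\ forall a u v, K u -> K v -> K (a * u + v).

Lemma is_idealD K u v : is_ideal K -> K u -> K v -> K (u + v).
Proof. by case=> _ hK Ku Kv; rewrite -[u]mul1r; apply: hK. Qed.

Lemma is_idealM K a u : is_ideal K -> K u -> K (a * u).
Proof. by case=> K0 hK Ku; rewrite -[_ * _]addr0; apply: hK. Qed.

Lemma is_idealB K u v : is_ideal K -> K u -> K v -> K (u - v).
Proof.
by move=> hK Ku Kv; apply: is_idealD => //; rewrite -mulN1r; apply: is_idealM.
Qed.

Lemma is_ideal_gen (G : set R) : is_ideal (ideal_gen G).
Proof.
split; first by exists [::]; split=> //; rewrite big_nil.
move=> a _ _ [l1 [h1 ->]] [l2 [h2 ->]].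
exists ([seq (a * p.1, p.2) | p <- l1] ++ l2); split=> [p|].
  by rewrite mem_cat => /orP[/mapP[q /h1[_ ?] ->]|/h2].
by rewrite big_cat big_map /= mulr_sumr; congr (_ + _); apply: eq_bigr => ? _; rewrite mulrA.
Qed.

Lemma mem_ideal_gen (G : set R) g : G g -> ideal_gen G g.
Proof.
move=> Gg; exists [:: (1, g)]; split; last by rewrite big_seq1 mul1r.
by move=> p; rewrite inE => /eqP->.
Qed.

Lemma ideal_gen_min (G K : set R) : is_ideal K ->
  (forall g, G g -> K g) -> forall x, ideal_gen G x -> K x.
Proof.
move=> hK GK _ [l [hl ->]]; elim: l hl => [|p l IH] hl.
  by rewrite big_nil; case: hK.
rewrite big_cons; apply: is_idealD => //; last first.
  by apply: IH => q ql; apply: hl; rewrite inE ql orbT.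
by apply: is_idealM => //; apply: GK; case: (hl p (mem_head _ _)).
Qed.

(** The ideal K + (fs). Adding the generators one at a time makes passing to
    the quotient by one of them a change of the base K. *)
Fixpoint adjoin K fs : set R :=
  if fs is f :: gs then [set x | exists t, adjoin K gs (x - f * t)] else K.

Lemma is_ideal_adjoin K fs : is_ideal K -> is_ideal (adjoin K fs).
Proof.
move=> hK; elim: fs => //= f fs [IH0 IH].
split=> /=; first by exists 0; rewrite mulr0 subr0.
move=> a u v [t ht] [t' ht']; exists (a * t + t').
suff -> : a * u + v - f * (a * t + t') = a * (u - f * t) + (v - f * t').
  exact: IH.
by ring.
Qed.

Lemma adjoin_base K fs x : K x -> adjoin K fs x.
Proof. by move=> Kx; elim: fs => //= f fs IH; exists 0; rewrite mulr0 subr0. Qed.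

Lemma mem_adjoin K fs f : is_ideal K -> f \in fs -> adjoin K fs f.
Proof.
move=> [K0 _]; elim: fs => //= g fs IH; rewrite inE => /predU1P[->|/IH h].
  by exists 1; rewrite mulr1 subrr; apply: adjoin_base.
by exists 0; rewrite mulr0 subr0.
Qed.

Lemma adjoin_min K K' fs : is_ideal K' -> (forall x, K x -> K' x) ->
  (forall f, f \in fs -> K' f) -> forall x, adjoin K fs x -> K' x.
Proof.
move=> hK' KK'; elim: fs => [_ x /KK'//|f fs IH hf x /= [t ht]].
rewrite -[x](subrK (f * t)); apply: is_idealD => //.
  by apply: IH ht => g gfs; apply: hf; rewrite inE gfs orbT.
by rewrite mulrC; apply: is_idealM => //; apply: hf; rewrite mem_head.
Qed.

Lemma adjoin_rcons K f fs : adjoin (adjoin K [:: f]) fs = adjoin K (rcons fs f).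
Proof. by elim: fs => //= g fs ->. Qed.

Lemma ideal_gen_adjoin (G : set R) fs : (forall x, G x <-> x \in fs) ->
  forall x, ideal_gen G x <-> adjoin [set 0] fs x.
Proof.
have h0 : is_ideal [set (0 : R)].
  by split=> //= a u v -> ->; rewrite mulr0 addr0.
move=> hG x; split.
  apply: ideal_gen_min; first exact: is_ideal_adjoin.
  by move=> g /hG; apply: mem_adjoin.
apply: adjoin_min; first exact: is_ideal_gen.
  by move=> y ->; case: (is_ideal_gen G).
by move=> f /hG; apply: mem_ideal_gen.
Qed.

(** The ideal K + (fs)^m, the whole ring for m = 0. With J the ideal of gs,
    the recursion is (f, J)^(m+1) = f (f, J)^m + J^(m+1): the decomposition
    on which the arguments below operate. *)
Fixpoint adjoin_pow K fs : nat -> set R :=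
  if fs is f :: gs then
    fix p m : set R :=
      if m is m'.+1 then
        [set x | exists z w, [/\ x = f * z + w, p m' z & adjoin_pow K gs m'.+1 w]]
      else setT
  else fun m => if m is 0%N then setT else K.

Lemma adjoin_pow_consS K f fs m x : adjoin_pow K (f :: fs) m.+1 x <->
  exists z w, [/\ x = f * z + w, adjoin_pow K (f :: fs) m z & adjoin_pow K fs m.+1 w].
Proof. by []. Qed.

Lemma adjoin_pow0 K fs x : adjoin_pow K fs 0 x. Proof. by case: fs. Qed.

Lemma is_ideal_adjoin_pow K fs m : is_ideal K -> is_ideal (adjoin_pow K fs m).
Proof.
move=> hK; elim: fs m => [|f fs IH] m; first by case: m.
elim: m => [//|m IHm]; split.
  by exists 0, 0; rewrite mulr0 addr0; split=> //; [case: IHm|case: (IH m.+1)].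
move=> a _ _ [z [w [-> hz hw]]] [z' [w' [-> hz' hw']]].
exists (a * z + z'), (a * w + w'); split; first by ring.
  by case: IHm => _; apply.
by case: (IH m.+1) => _; apply.
Qed.

Lemma adjoin_pow_base K fs m x : is_ideal K -> K x -> adjoin_pow K fs m x.
Proof.
move=> hK Kx; elim: fs m => [|f fs IH] [|m] //; apply/adjoin_pow_consS.
exists 0, x; rewrite mulr0 add0r; split=> //.
by case: (is_ideal_adjoin_pow (f :: fs) m hK).
Qed.

Lemma adjoin_pow_cons K f fs m x : is_ideal K ->
  adjoin_pow K fs m x -> adjoin_pow K (f :: fs) m x.
Proof.
move=> hK; case: m => [//|m] h; apply/adjoin_pow_consS.
exists 0, x; rewrite mulr0 add0r; split=> //.
by case: (is_ideal_adjoin_pow (f :: fs) m hK).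
Qed.

Lemma adjoin_powS_sub K fs m x : is_ideal K -> adjoin_pow K fs m.+1 x -> adjoin_pow K fs m x.
Proof.
move=> hK; elim: fs m x => [|f fs IH] m x; first by case: m.
elim: m x => [//|m IHm] x /adjoin_pow_consS[z [w [-> hz hw]]].
by apply/adjoin_pow_consS; exists z, w; split=> //; [apply: IHm|apply: IH].
Qed.

Lemma adjoin_pow_mem_mul K fs m f x : is_ideal K -> f \in fs ->
  adjoin_pow K fs m x -> adjoin_pow K fs m.+1 (f * x).
Proof.
move=> hK; elim: fs m x => [//|g fs IH] m x.
rewrite inE => /predU1P[<-|ffs].
  move=> hx; apply/adjoin_pow_consS; exists x, 0; rewrite addr0; split=> //.
  by case: (is_ideal_adjoin_pow fs m.+1 hK).
elim: m x => [|m IHm] x.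
  by move=> _; apply: adjoin_pow_cons => //; apply: IH => //; apply: adjoin_pow0.
move=> /adjoin_pow_consS[z [w [-> hz hw]]]; apply/adjoin_pow_consS.
by exists (f * z), (f * w); split; [ring|apply: IHm|apply: IH].
Qed.

Lemma adjoin_pow_mul K fs m g x : is_ideal K -> adjoin K fs g ->
  adjoin_pow K fs m x -> adjoin_pow K fs m.+1 (g * x).
Proof.
move=> hK hg hx; have hI : is_ideal (fun g => adjoin_pow K fs m.+1 (g * x)).
  split; first by rewrite mul0r; case: (is_ideal_adjoin_pow fs m.+1 hK).
  move=> a u v hu hv; rewrite mulrDl -mulrA.
  by case: (is_ideal_adjoin_pow fs m.+1 hK) => _; apply.
apply: (adjoin_min hI _ _ hg) => [y Ky|f]; last by move=> ?; apply: adjoin_pow_mem_mul.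
by rewrite mulrC; apply: is_idealM; [apply: is_ideal_adjoin_pow|apply: adjoin_pow_base].
Qed.

Lemma adjoin_pow1 K fs x : adjoin_pow K fs 1 x <-> adjoin K fs x.
Proof.
elim: fs x => [//|f fs IH] x; split.
  by move=> [z [w [-> _ /IH hw]]]; exists z; rewrite addrC addKr.
by move=> [t /IH ht]; exists t, (x - f * t); split=> //; ring.
Qed.

Lemma ideal_pow_sub_adjoin_pow K fs (I : set R) m : is_ideal K ->
  (forall x, I x -> adjoin K fs x) ->
  forall x, ideal_pow I m x -> adjoin_pow K fs m x.
Proof.
move=> hK hI; apply: ideal_gen_min; first exact: is_ideal_adjoin_pow.
move=> _ [f [hf ->]]; elim: m f hf => [|m IH] f hf; first exact: adjoin_pow0.
rewrite big_ord_recl; apply: adjoin_pow_mul => //; first exact/hI.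
by apply: IH => i; apply: hf.
Qed.

(** Modulo f the power (fs)^m becomes the power of the image of (fs). This
    replaces the quotient ring R/f in inductions over a regular sequence. *)
Lemma adjoin_pow_adjoin K f fs m x : is_ideal K ->
  adjoin_pow (adjoin K [:: f]) fs m x <-> exists t, adjoin_pow K fs m (x - f * t).
Proof.
move=> hK; split; last first.
  move=> [t ht]; rewrite -[x](subrK (f * t)).
  have hK1 := is_ideal_adjoin [:: f] hK.
  apply: is_idealD; first exact: is_ideal_adjoin_pow.
    elim: fs m {x} (x - f * t) ht => [|g fs IH] m x.
      by case: m => //= _ ?; exists 0; rewrite mulr0 subr0.
    elim: m x => [//|m IHm] x /adjoin_pow_consS[z [w [-> hz hw]]].
    by apply/adjoin_pow_consS; exists z, w; split=> //; [apply: IHm|apply: IH].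
  by apply: adjoin_pow_base => //=; exists t; rewrite subrr; case: hK.
elim: fs m x => [|g fs IH] m x.
  by case: m => // _; exists 0.
elim: m x => [|m IHm] x; first by exists 0.
move=> /adjoin_pow_consS[z [w [-> /IHm[t ht] /IH[t' ht']]]]; exists (g * t + t').
apply/adjoin_pow_consS; exists (z - f * t), (w - f * t'); split=> //; ring.
Qed.

Section Regular.
Variables (I : eqType) (F : I -> R).
Implicit Types (js : seq I) (i j : I).

(** Every ordering of every part of the family is a regular sequence modulo K,
    except that properness is not asked for: this is stable under passing to
    a subfamily and to the quotient by a member. *)
Definition permutably_regular K js := forall l j, uniq (j :: l) ->
  {subset j :: l <= js} ->
  forall x, adjoin K (map F l) (F j * x) -> adjoin K (map F l) x.

Lemma permutably_regular_sub K js js' : {subset js' <= js} ->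
  permutably_regular K js -> permutably_regular K js'.
Proof. by move=> h H l j Hu Hs; apply: H => // i /Hs /h. Qed.

Lemma permutably_regular_adjoin K j js : j \notin js ->
  permutably_regular K (j :: js) -> permutably_regular (adjoin K [:: F j]) js.
Proof.
move=> jjs H l i /= /andP[il ul] Hs x; rewrite adjoin_rcons -map_rcons.
apply: H => [|i'] /=.
  rewrite mem_rcons inE negb_or il rcons_uniq ul !andbT.
  apply/andP; split; last first.
    by apply: contra jjs => jl; apply: Hs; rewrite inE jl orbT.
  by apply: contraNneq jjs => <-; apply: Hs; rewrite mem_head.
rewrite inE mem_rcons inE => /or3P[/eqP->|/eqP->|h].
- by rewrite inE Hs ?orbT ?mem_head.
- by rewrite mem_head.
- by rewrite inE Hs ?orbT // inE h orbT.
Qed.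

(** An element regular together with a sequence stays a nonzerodivisor modulo
    all powers of the ideal of the sequence. By induction on the power, x
    already lies in the previous power; its part not divisible by the head f
    is treated modulo f with the shorter sequence, after which f can be
    cancelled and the exponent drops by one. *)
Lemma adjoin_pow_nzd K js i m x : is_ideal K -> uniq (i :: js) ->
  permutably_regular K (i :: js) ->
  adjoin_pow K (map F js) m (F i * x) -> adjoin_pow K (map F js) m x.
Proof.
elim: js K i m x => [|j js IH] K i m x hK Hu Hr.
  by case: m => [|m] //=; apply: (Hr [::] i).
have := Hu; rewrite [uniq _]/= inE negb_or => /andP[/andP[ij ijs] /andP[jjs ujs]].
have hr2 : permutably_regular K (j :: js).
  by apply: permutably_regular_sub Hr => i' h; rewrite inE h orbT.
have hK1 := is_ideal_adjoin [:: F j] hK.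
have hr3 : permutably_regular (adjoin K [:: F j]) (i :: js).
  apply: permutably_regular_adjoin; first by rewrite inE negb_or eq_sym ij.
  by apply: permutably_regular_sub Hr => i'; rewrite !inE; case: eqP; rewrite ?orbT.
have IHj := IH _ j _ _ hK _ hr2.
have IHi := IH _ i _ _ hK1 _ hr3.
have hp fs m' := is_ideal_adjoin_pow fs m' hK.
rewrite map_cons.
elim: m x => [//|[|m] IHm] x.
  by move/adjoin_pow1 => h; apply/adjoin_pow1; apply: (Hr (j :: js) i).
(* Now x = f z + w by the induction on m; modulo f, the product of F i and w
   lies in the (m+2)-nd power, hence so does w, up to a multiple of f. *)
move=> h; move: (IHm _ (adjoin_powS_sub hK h)) => /adjoin_pow_consS[z [w [Ex hz hw]]].
move/adjoin_pow_consS: (h) => [p [q [Epq hpp hq]]].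
have /IHi : adjoin_pow (adjoin K [:: F j]) (map F js) m.+2 (F i * w).
  apply/adjoin_pow_adjoin => //; exists (p - F i * z).
  suff -> : F i * w - F j * (p - F i * z) = q by [].
  have -> : w = x - F j * z by rewrite Ex; ring.
  have -> : q = F i * x - F j * p by rewrite Epq; ring.
  by ring.
rewrite [uniq _]/= ijs ujs => /(_ isT) /(adjoin_pow_adjoin _ _ _ _ hK)[t ht].
have {}ht' : adjoin_pow K (map F js) m.+1 t.
  apply: IHj; first by rewrite /= jjs ujs.
  have -> : F j * t = w - (w - F j * t) by ring.
  by apply: is_idealB => //; apply: adjoin_powS_sub.
(* With w' in the (m+2)-nd power only the multiple f (z + t) remains, and f
   cancels because it is a nonzerodivisor modulo powers of the tail. *)
set w' := w - F j * t in ht.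
have Ex' : x = F j * (z + t) + w' by rewrite Ex /w'; ring.
rewrite Ex'.
have hfz : adjoin_pow K (F j :: map F js) m.+2 (F i * (F j * (z + t))).
  have -> : F i * (F j * (z + t)) = F i * x - F i * w' by rewrite Ex'; ring.
  by apply: is_idealB => //; apply: is_idealM => //; apply: adjoin_pow_cons.
move/adjoin_pow_consS: hfz => [p' [q' [E' hp' hq']]].
apply/adjoin_pow_consS; exists (z + t), w'; split=> //.
apply: IHm; rewrite -[F i * _](subrK p'); apply: is_idealD => //.
apply: adjoin_pow_cons => //; apply: adjoin_powS_sub => //.
apply: IHj; first by rewrite /= jjs ujs.
suff -> : F j * (F i * (z + t) - p') = q' by [].
have -> : q' = F i * (F j * (z + t)) - F j * p' by rewrite E'; ring.
by ring.
Qed.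

(** From f x = f z + w with w in a power of the tail, f (x - z) = w can be
    divided by f, a nonzerodivisor modulo that power. *)
Lemma adjoin_pow_cancel_head K j js m x : is_ideal K -> uniq (j :: js) ->
  permutably_regular K (j :: js) ->
  adjoin_pow K (map F (j :: js)) m.+1 (F j * x) ->
  adjoin_pow K (map F (j :: js)) m x.
Proof.
move=> hK Hu Hr /adjoin_pow_consS[z [w [E hz hw]]].
rewrite -[x](subrK z); apply: is_idealD => //; first exact: is_ideal_adjoin_pow.
apply: adjoin_pow_cons => //; apply: adjoin_powS_sub => //.
apply: (adjoin_pow_nzd hK Hu Hr).
suff -> : F j * (x - z) = w by [].
by rewrite mulrBr E; ring.
Qed.

(** Quasi-regularity for a single monomial. The powers of the head are
    cancelled one by one; then the head is absorbed into the base ideal and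
    the same is done with the tail. *)
Lemma adjoin_pow_monomial K js (e : I -> nat) u : is_ideal K -> uniq js ->
  permutably_regular K js ->
  adjoin_pow K (map F js) (\sum_(j <- js) e j).+1 (u * \prod_(j <- js) F j ^+ e j) ->
  adjoin K (map F js) u.
Proof.
elim: js K => [|j js IH] K hK Hu Hr; first by rewrite !big_nil mulr1.
rewrite !big_cons; set d := (\sum_(j <- js) e j)%N.
set v := u * \prod_(j <- js) F j ^+ e j.
rewrite mulrCA -/v.
have -> : (e j + d).+1 = (e j + d.+1)%N by rewrite addnS.
elim: (e j) => [|a IHa]; last first.
  by rewrite exprS -mulrA addSn => /(adjoin_pow_cancel_head hK Hu Hr).
rewrite expr0 mul1r => /adjoin_pow_consS[z [w [E _ hw]]].
move: Hu => /= /andP[jjs ujs].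
have /IH : permutably_regular (adjoin K [:: F j]) js by apply: permutably_regular_adjoin.
have hK1 := is_ideal_adjoin [:: F j] hK.
move=> /(_ hK1 ujs); rewrite -/d -/v => H.
have : adjoin (adjoin K [:: F j]) (map F js) u.
  by apply: H; apply/adjoin_pow_adjoin => //; exists z; rewrite E addrC addKr.
move/adjoin_pow1/adjoin_pow_adjoin => /(_ hK) [t /adjoin_pow1 ht].
by exists t.
Qed.

End Regular.
End PowersOfIdeals.

(** * Polynomial rings are noetherian and have associated primes *)

Section Noetherian.
Set Implicit Arguments.
Unset Strict Implicit.
Local Open Scope classical_set_scope.
Import Order.TTheory.

Definition noetherian (R : comNzRingType) := forall J : nat -> set R,
  (forall i, is_ideal (J i)) -> (forall i x, J i x -> J i.+1 x) ->
  exists i, forall x, J i.+1 x -> J i x.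

(** An annihilator (K : x) that is not prime, say with a b in it but neither a
    nor b, is strictly contained in the proper annihilator (K : a x). Going on
    in this way would give a strictly ascending chain. *)
Lemma exists_associated_prime (R : comNzRingType) (K : set R) :
  noetherian R -> is_ideal K -> ~ K 1 -> exists P, associated_prime K P.
Proof.
move=> hR hK K1; apply: contrapT => noP.
pose colon x : set R := [set r | K (r * x)].
have hcolon x : is_ideal (colon x).
  split; rewrite /colon /=; first by rewrite mul0r; case: hK.
  by move=> a u v hu hv; rewrite mulrDl -mulrA; case: hK => _; apply.
have step x : exists y, ~ K x -> [/\ ~ K y,
    forall r, colon x r -> colon y r & exists b, colon y b /\ ~ colon x b].
  have [Kx|Kx] := pselect (K x); first by exists x.
  have [|nprime] := pselect (prime_ideal (colon x)).
    by move=> px; case: noP; exists (colon x); split=> //; exists x.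
  have [[a b] [hab ha hb]] : exists p,
      [/\ colon x (p.1 * p.2), ~ colon x p.1 & ~ colon x p.2].
    apply: contrapT => nab; apply: nprime; split.
      split; first by rewrite in_setE; case: (hcolon x).
        by apply/negP; rewrite in_setE /colon /= mul1r.
      by move=> a u v; rewrite !in_setE; case: (hcolon x) => _; apply.
    move=> u v; rewrite in_setE => huv.
    have [|hu] := boolP (u \in mem (colon x)) => //=.
    apply: contrapT => hv; apply: nab; exists (u, v); split=> //= h.
      by move/negP: hu; apply; rewrite in_setE.
    by apply: hv; rewrite in_setE.
  exists (a * x) => _; split=> // [r|].
    by rewrite /colon /= mulrCA => ?; apply: is_idealM.
  by exists b; split=> //; rewrite /colon /= mulrA [b * a]mulrC.
have [y hy] := choice step.
pose z i := iter i y 1.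
have zK i : ~ K (z i) by elim: i => //= i /hy[].
have [|i x|i hi] := hR (fun i => colon (z i)) _.
- by [].
- by case: (hy _ (zK i)) => _ h _; apply: h.
by case: (hy _ (zK i)) => _ _ [b [/hi hb]]; apply.
Qed.

(** Repeatedly jump to an index at which u is minimal among all later
    values. *)
Lemma nondecreasing_subseq (u : nat -> nat) : exists f : nat -> nat,
  {homo f : i j / (i < j)%N} /\ {homo u \o f : i j / (i <= j)%N}.
Proof.
have step N : exists i, (N <= i)%N /\ forall j, (N <= j)%N -> (u i <= u j)%N.
  have ex : exists v, `[< exists2 i, (N <= i)%N & u i = v >].
    by exists (u N); apply/asboolP; exists N.
  case: (ex_minnP ex) => v /asboolP[i Ni uiv] vmin.
  exists i; split=> // j Nj; rewrite uiv; apply: vmin.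
  by apply/asboolP; exists j.
have [g hg] := choice step.
pose f := fix f k := if k is k'.+1 then g (f k').+1 else g 0%N.
have fS i : (f i < f i.+1)%N by exact: (proj1 (hg (f i).+1)).
have fE i : exists N, f i = g N by case: i => [|i]; [exists 0%N|exists (f i).+1].
exists f; split; first by apply: homo_ltn => // ? ? ?; apply: ltn_trans.
apply: (@homo_leq _ (u \o f) (fun a b => a <= b)%N) => // [? ? ?|i].
  exact: leq_trans.
case: (fE i) (fS i) => N /= -> ltN; case: (hg N) => leN; apply.
exact: leq_trans leN (ltnW ltN).
Qed.

(** Extract subsequences on which one coordinate after another is
    nondecreasing. *)
Lemma dickson n (m : nat -> 'X_{1..n}) :
  exists i j, (i < j)%N /\ (m i <= m j)%MM.
Proof.
have H k : exists f : nat -> nat, {homo f : i j / (i < j)%N} /\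
    forall l : 'I_n, (l < k)%N -> {homo (fun i => m (f i) l) : i j / (i <= j)%N}.
  elim: k => [|k [f [hf hm]]]; first by exists id; split=> // l; rewrite ltn0.
  have [nk|kn] := leqP n k.
    by exists f; split=> // l _; apply: hm; apply: leq_trans nk.
  have [g [hg hmg]] := nondecreasing_subseq (fun i => m (f i) (Ordinal kn)).
  exists (f \o g); split=> [i j ij|l]; first by apply/hf/hg.
  rewrite ltnS leq_eqVlt => /predU1P[lk|lk] i j ij.
    have -> : l = Ordinal kn by apply: val_inj.
    exact: hmg.
  apply: (hm l lk); apply: (@homo_leq _ g (fun a b => a <= b)%N) => //.
    by move=> ? ? ?; apply: leq_trans.
  by move=> i'; apply/ltnW/hg.
have [f [hf hm]] := H n.
exists (f 0%N), (f 1%N); split; first exact: hf.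
by apply/mnm_lepP => l; apply: (hm l).
Qed.

(** Among the elements of J' outside J take one with the smallest leading
    monomial: if an h in J had a leading monomial dividing it, cancelling the
    leading term with a multiple of h would give a smaller one. *)
Lemma mlead_new_generator n (k : fieldType) (J J' : set {mpoly k[n]}) :
  is_ideal J -> is_ideal J' -> (forall x, J x -> J' x) ->
  (exists x, J' x /\ ~ J x) ->
  exists g, [/\ J' g, ~ J g &
    forall h, J h -> h != 0 -> ~~ (mlead h <= mlead g)%MM].
Proof.
move=> hJ hJ' JJ' [x [J'x Jx]]; elim/mleadrect: x J'x Jx => g IH J'g Jg.
have [//|nh] := pselect (exists g, [/\ J' g, ~ J g &
  forall h, J h -> h != 0 -> ~~ (mlead h <= mlead g)%MM]).
case: (nh); exists g; split=> // h Jh h0; apply/negP => hg.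
pose m := mlead g; pose h' := 'X_[m - mlead h] * h.
have Jh' : J h' by apply: is_idealM.
have h'0 : h' != 0.
  by rewrite mulf_neq0 // -mleadc_eq0 mleadXm mcoeffX eqxx oner_eq0.
have lh' : mlead h' = m.
  by rewrite mleadM ?mleadXm ?submK // -mleadc_eq0 mleadXm mcoeffX eqxx oner_eq0.
pose q := g - (g@_m / h'@_m) *: h'.
have Jq : J ((g@_m / h'@_m) *: h') by rewrite -mul_mpolyC; apply: is_idealM.
have nJq : ~ J q.
  by move=> h1; apply: Jg; rewrite -[g](subrK ((g@_m / h'@_m) *: h')); apply: is_idealD.
have q0 : q != 0 by apply/eqP => q0; apply: nJq; rewrite q0; case: hJ.
have qm : q@_m = 0.
  rewrite mcoeffB mcoeffZ -mulrA mulVf ?mulr1 ?subrr //.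
  by rewrite -lh' mleadc_eq0.
case: (IH q _ _ nJq).
- rewrite lt_neqAle; apply/andP; split.
    by apply/eqP => e; move: q0; rewrite -mleadc_eq0 e qm eqxx.
  apply: le_trans (mleadB_le _ _) _; rewrite leUx lexx /=.
  by apply: le_trans (mleadZ_le _ _) _; rewrite lh'.
- by apply: is_idealB => //; apply: JJ'.
by move=> g' hg'; apply: nh; exists g'.
Qed.

(** In a strictly ascending chain, new generators g_i of J_(i+1) modulo J_i
    as above have leading monomials none of which divides a later one,
    contradicting Dickson's lemma. *)
Lemma mpoly_noetherian n (k : fieldType) : noetherian {mpoly k[n]}.
Proof.
move=> J hJ hS; apply: contrapT => nst.
have step i : exists g, [/\ J i.+1 g, ~ J i g &
    forall h, J i h -> h != 0 -> ~~ (mlead h <= mlead g)%MM].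
  apply: mlead_new_generator => //; first exact: hS.
  apply: contrapT => nx; apply: nst; exists i => x Jx.
  by apply: contrapT => Jix; apply: nx; exists x.
have [g hg] := choice step.
have [i [j [ij]]] := dickson (fun i => mlead (g i)).
have mono : forall a b, (a <= b)%N -> forall x, J a x -> J b x.
  apply: (@homo_leq _ J (fun A B => forall x, A x -> B x)) => // B A C h1 h2 x.
  by move=> /h1/h2.
case: (hg i) (hg j) => Jg nJg _ [_ _ hgj]; apply/negP/hgj.
  exact: mono ij _ Jg.
by apply/eqP => g0; apply: nJg; rewrite g0; case: (hJ i).
Qed.

End Noetherian.

(** * Prime ideals and contractions from localizations *)

Section PrimesAndLocalization.
Set Implicit Arguments.
Unset Strict Implicit.
Local Open Scope classical_set_scope.

Lemma prime_is_ideal (R : comNzRingType) (P : set R) :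
  prime_ideal P -> is_ideal P.
Proof.
case=> -[P0 _ hP] _; split; first by rewrite in_setE in P0.
by move=> a u v; have := hP a u v; rewrite !in_setE.
Qed.

Lemma prime_not1 (R : comNzRingType) (P : set R) : prime_ideal P -> ~ P 1.
Proof. by case=> -[_ /negP P1 _] _ h; apply: P1; rewrite in_setE. Qed.

Lemma prime_notM (R : comNzRingType) (P : set R) a b :
  prime_ideal P -> ~ P a -> ~ P b -> ~ P (a * b).
Proof.
case=> _ hP Pa Pb Pab; have := hP a b.
by rewrite in_setE => /(_ Pab) /orP[]; rewrite in_setE.
Qed.

Lemma prime_notX (R : comNzRingType) (P : set R) a e :
  prime_ideal P -> ~ P a -> ~ P (a ^+ e).
Proof.
move=> hP Pa; elim: e => [|e IH]; first by rewrite expr0; apply: prime_not1.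
by rewrite exprS; apply: prime_notM.
Qed.

Lemma prime_not_prod (R : comNzRingType) (P : set R) (T : finType)
    (Q : pred T) (G : T -> R) : prime_ideal P ->
  (forall i, Q i -> ~ P (G i)) -> ~ P (\prod_(i | Q i) G i).
Proof.
move=> hP hG; elim/big_rec: _ => [|i x Qi hx]; first exact: prime_not1.
by apply: prime_notM => //; apply: hG.
Qed.

(** Clearing denominators turns membership in J R_P into a statement in R. *)
Lemma loc_contractionP (R : idomainType) (J P : set R) x :
  is_ideal J -> prime_ideal P ->
  loc_contraction J P x <-> exists u, ~ P u /\ J (u * x).
Proof.
move=> hJ hP; have Pn0 u : ~ P u -> u != 0.
  by move=> Pu; apply/eqP => u0; apply: Pu; rewrite u0; case: (prime_is_ideal hP).
split=> [[l [hl /= xE]]|[u [Pu Jux]]]; last first.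
  exists [:: (tofrac 1 / tofrac u, tofrac (u * x))]; split.
    move=> p; rewrite inE => /eqP-> /=; split; last by exists (u * x).
    by exists 1, u.
  rewrite big_seq1 /= tofrac1 mul1r tofracM mulKf //.
  by rewrite tofrac_eq0 Pn0.
suff [u [y [Pu Jy E]]] : exists u y, [/\ ~ P u, J y &
    tofrac u * (\sum_(p <- l) p.1 * p.2) = tofrac y].
  exists u; split=> //; move: E; rewrite -xE -tofracM => /eqP.
  by rewrite tofrac_eq => /eqP->.
elim: l hl {xE} => [|p l IH] hl.
  exists 1, 0; rewrite big_nil mulr0 tofrac0; split=> //; last by case: hJ.
  exact: prime_not1.
have [q ql|u [y [Pu Jy E]]] := IH; first by apply: hl; rewrite inE ql orbT.
have [[a [b [Pb Ep1]]] [g Jg Ep2]] := hl p (mem_head _ _).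
exists (b * u), (u * a * g + b * y); split.
- exact: prime_notM.
- by case: (hJ) => _; apply=> //; apply: is_idealM.
rewrite big_cons Ep1 -Ep2 !(tofracM, tofracD) -E.
have nb : tofrac b != 0 by rewrite tofrac_eq0 Pn0.
by field.
Qed.

Lemma is_ideal_ideal_pow (R : comNzRingType) (I : set R) m :
  is_ideal (ideal_pow I m).
Proof. exact: is_ideal_gen. Qed.

Lemma ideal_pow_mul (R : comNzRingType) (I : set R) m g x :
  I g -> ideal_pow I m x -> ideal_pow I m.+1 (g * x).
Proof.
move=> Ig; apply: (ideal_gen_min (K := fun x => ideal_pow I m.+1 (g * x))).
  have [h0 hI] := is_ideal_ideal_pow I m.+1.
  split; first by rewrite mulr0.
  by move=> a u v hu hv; rewrite mulrDr mulrCA; apply: hI.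
move=> _ [f [hf ->]]; apply: mem_ideal_gen.
exists (fun i => if unlift ord0 i is Some j then f j else g); split.
  by move=> i; case: unliftP.
rewrite big_ord_recl unlift_none; congr (_ * _); apply: eq_bigr => i _.
by rewrite liftK.
Qed.

Lemma ideal_pow_anti (R : comNzRingType) (I : set R) m n x :
  (m <= n)%N -> ideal_pow I n x -> ideal_pow I m x.
Proof.
move=> /subnKC <-; elim: (n - m)%N => [|d IH]; first by rewrite addn0.
rewrite addnS => h; apply: IH.
apply: ideal_gen_min h; first exact: is_ideal_gen.
move=> _ [f [hf ->]]; rewrite big_ord_recl.
apply: is_idealM; first exact: is_ideal_gen.
by apply: mem_ideal_gen; exists (fun i => f (lift ord0 i)).
Qed.

End PrimesAndLocalization.

(** * Symbolic powers of the star configuration ideal *)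

Section StarConfiguration.
Set Implicit Arguments.
Unset Strict Implicit.
Local Open Scope classical_set_scope.
Variables (R : idomainType) (s c : nat) (F : 'I_s -> R).
Hypothesis c_lt_s : (c < s)%N.
Hypothesis F_reg : forall J : seq 'I_s, uniq J -> size J = c.+1 ->
  regular_sequence [seq F j | j <- J].
Implicit Types (A B : {set 'I_s}) (P : set R).

Local Notation idF A := (ideal_gen (F @` [set` A])).
Local Notation I := (star_ideal F c).

Lemma mem_idF A j : j \in A -> idF A (F j).
Proof. by move=> jA; apply: mem_ideal_gen; exists j. Qed.

Lemma idF_adjoin A x : idF A x <-> adjoin [set 0] (map F (enum A)) x.
Proof.
apply: ideal_gen_adjoin => y; split=> [[j /= jA <-]|/mapP[j]].
  by rewrite map_f // mem_enum.
by rewrite mem_enum => jA ->; exists j.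
Qed.

Lemma extend_uniq (l : seq 'I_s) : uniq l -> (size l <= c.+1)%N ->
  exists r, uniq (l ++ r) /\ size (l ++ r) = c.+1.
Proof.
move=> ul sl; pose r : seq 'I_s := [seq i <- enum 'I_s | i \notin l].
have pr : perm_eq (l ++ r) (enum 'I_s).
  apply: uniq_perm; rewrite ?enum_uniq //.
    rewrite cat_uniq ul filter_uniq ?enum_uniq // andbT /=.
    by apply/hasPn => i; rewrite mem_filter => /andP[].
  by move=> i; rewrite mem_cat mem_filter !mem_enum andbT /= orbN.
exists (take (c.+1 - size l) r); split.
  have : uniq (l ++ r) by rewrite (perm_uniq pr) enum_uniq.
  by rewrite -{1}(cat_take_drop (c.+1 - size l) r) catA cat_uniq => /andP[].
have := perm_size pr; rewrite !size_cat size_enum_ord size_take.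
by case: ltnP; move: sl c_lt_s; move: (size r) (size l) => a b; lia.
Qed.

(** The hypothesis covers sequences of exactly c + 1 members, in any order; an
    initial segment l, j is completed to one of them. *)
Lemma permutably_regular_family (js : seq 'I_s) : uniq js -> (size js <= c.+1)%N ->
  permutably_regular F [set 0] js.
Proof.
move=> ujs sjs l j ujl hl x hx.
have [r [ur sr]] : exists r, uniq ((j :: l) ++ r) /\ size ((j :: l) ++ r) = c.+1.
  by apply: extend_uniq => //; apply: leq_trans sjs; apply: uniq_leq_size.
have p : perm_eq ((j :: l) ++ r) (l ++ j :: r).
  by rewrite perm_sym perm_catC /= perm_cons perm_catC.
have [|h _] := F_reg _ (etrans (esym (perm_size p)) sr).
  by rewrite -(perm_uniq p).
have := h (size l) x; rewrite map_cat /= -(size_map F l) take_size_cat //.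
rewrite nth_cat ltnn subnn size_cat /= addnS ltnS leq_addr => {}h.
have E := @ideal_gen_adjoin _ [set` map F l] (map F l) (fun _ => conj id id).
by apply/E/h => //; apply/E.
Qed.

Lemma idF_nzd A j x : (#|A| <= c)%N -> j \notin A -> idF A (F j * x) -> idF A x.
Proof.
move=> Ac jA /idF_adjoin h; apply/idF_adjoin.
apply: (permutably_regular_family (js := j :: enum A)) h => //.
- by rewrite /= enum_uniq mem_enum jA.
- by rewrite /= -cardE.
by rewrite /= enum_uniq mem_enum jA.
Qed.

Lemma idF_nzd_prod A x : (#|A| <= c)%N ->
  idF A ((\prod_(i in ~: A) F i) * x) -> idF A x.
Proof.
move=> Ac; elim/big_rec: _ x => [x|i y]; first by rewrite mul1r.
rewrite inE => iA IH x; rewrite -mulrA => /(idF_nzd Ac iA); exact: IH.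
Qed.

Lemma idF_proper A : (#|A| <= c)%N -> ~ idF A 1.
Proof.
move=> Ac; have [r [ur sr]] : exists r, uniq (enum A ++ r) /\ size (enum A ++ r) = c.+1.
  by apply: extend_uniq; rewrite ?enum_uniq // -cardE ltnW.
have [_ nh] := F_reg ur sr; move=> h; apply: nh.
apply: ideal_gen_min h; first exact: is_ideal_gen.
move=> _ [j /= jA <-]; apply: mem_ideal_gen => /=.
by rewrite map_f // mem_cat mem_enum jA.
Qed.

(** For any other set B of c indices, the product contains some F_i with
    i in B. *)
Lemma mem_star A x : #|A| = c -> idF A x -> I (x * \prod_(i in ~: A) F i).
Proof.
move=> Ac hx B Bc; have [AB|] := boolP (A == B).
  by rewrite mulrC; apply: is_idealM; [apply: is_ideal_gen|rewrite -(eqP AB)].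
rewrite eq_sym finset.eqEcard Ac Bc leqnn andbT => /subsetPn[i iB iA].
rewrite (bigD1 i) ?inE //= mulrCA mulrC.
by apply: is_idealM; [apply: is_ideal_gen|apply: mem_idF].
Qed.

(** The set A is any one for which F_A does not contain x, where P = (I : x):
    if F_i were in P for some i outside A, it would be a zero divisor
    modulo F_A. *)
Lemma associated_star P : associated_prime I P ->
  exists A, #|A| = c /\ forall i, i \notin A -> ~ P (F i).
Proof.
move=> [hP [x EP]]; have [A [Ac nx]] : exists A, #|A| = c /\ ~ idF A x.
  apply: contrapT => h; apply: (prime_not1 hP); rewrite EP /= mul1r => A Ac.
  by apply: contrapT => nx; apply: h; exists A.
exists A; split=> // i iA; rewrite EP /= => h; apply: nx.
by apply: (idF_nzd (j := i)) => //; [rewrite Ac|apply: h].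
Qed.

(** An associated prime (F_A : x) of F_A is also (I : x u), where u is the
    product of the F_i with i outside A: u sends F_A into I, and it is a
    nonzerodivisor modulo F_A. *)
Lemma exists_associated_star A : noetherian R -> #|A| = c ->
  exists P, [/\ associated_prime I P, forall x, idF A x -> P x &
    forall i, i \notin A -> ~ P (F i)].
Proof.
move=> hR Ac; have Acle : (#|A| <= c)%N by rewrite Ac.
have [P [hP [x EP]]] :=
  exists_associated_prime hR (is_ideal_gen _) (idF_proper Acle).
exists P; split.
- split=> //; exists (x * \prod_(i in ~: A) F i); rewrite EP; apply/seteqP.
  split=> r /= h; first by rewrite mulrA; apply: mem_star.
  by apply: (idF_nzd_prod Acle); have := h A Ac; rewrite mulrA mulrC.
- by move=> y hy; rewrite EP /= mulrC; apply: is_idealM => //; apply: is_ideal_gen.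
move=> i iA; rewrite EP /= => /(idF_nzd Acle iA) hx; apply: (prime_not1 hP).
by rewrite EP /= mul1r.
Qed.

(** The unit of R_P used here is a power of the product u of the F_i with i
    outside A: each F_j u with j in A is in I by [mem_star]. *)
Lemma monomial_loc_contraction P A (a : 'I_s -> nat) m : prime_ideal P ->
  #|A| = c -> (forall i, i \notin A -> ~ P (F i)) ->
  (m <= \sum_(j in A) a j)%N ->
  loc_contraction (ideal_pow I m) P (\prod_j F j ^+ a j).
Proof.
move=> hP Ac hA hm; apply/loc_contractionP => //; first exact: is_ideal_gen.
pose u := \prod_(i in ~: A) F i.
exists (\prod_(j in A) u ^+ a j); split.
  apply: prime_not_prod => // j _; apply: prime_notX => //.
  by apply: prime_not_prod => // i; rewrite inE => /hA.
apply: ideal_pow_anti hm _; rewrite [X in _ * X](bigID (mem A)) /= mulrA.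
rewrite mulrC; apply: is_idealM; first exact: is_ideal_gen.
rewrite -big_split /=.
elim/big_rec2: _ => [|j x d jA hx].
  by apply: mem_ideal_gen; exists (fun=> 0); rewrite big_ord0; split=> // -[].
rewrite -exprMn; elim: (a j) => [|e IHe]; first by rewrite mul1r.
rewrite exprS -mulrA addSn; apply: ideal_pow_mul => //.
by rewrite mulrC; apply: mem_star => //; apply: mem_idF.
Qed.

(** Since I is contained in F_A and the F_i outside A are not in P, membership
    in I^m R_P becomes a relation about the part of the monomial supported
    in A, to which quasi-regularity applies. *)
Lemma loc_contraction_monomial P A (a : 'I_s -> nat) m : prime_ideal P ->
  #|A| = c -> (forall x, idF A x -> P x) ->
  (forall i, i \notin A -> ~ P (F i)) ->
  loc_contraction (ideal_pow I m) P (\prod_j F j ^+ a j) ->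
  (m <= \sum_(j in A) a j)%N.
Proof.
move=> hP Ac AP hA /loc_contractionP[]//; first exact: is_ideal_gen.
move=> u [Pu hu]; rewrite leqNgt; apply/negP => lt_m.
have h0 : is_ideal [set (0 : R)].
  by split=> //= b x y -> ->; rewrite mulr0 addr0.
have {}hu := ideal_pow_anti lt_m hu.
have {}hu : adjoin_pow [set 0] (map F (enum A)) (\sum_(j <- enum A) a j).+1
   ((u * \prod_(j in ~: A) F j ^+ a j) * \prod_(j <- enum A) F j ^+ a j).
  rewrite !big_enum /= -mulrA [X in u * X]mulrC.
  have -> : (\prod_(i in A) F i ^+ a i) * (\prod_(j in ~: A) F j ^+ a j) =
            \prod_j F j ^+ a j.
    by rewrite [RHS](bigID (mem A)) /=; congr (_ * _); apply: eq_bigl => i; rewrite inE.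
  apply: (ideal_pow_sub_adjoin_pow h0) hu => x hx.
  by apply/idF_adjoin; apply: hx.
have /idF_adjoin/AP : adjoin [set 0] (map F (enum A)) (u * \prod_(j in ~: A) F j ^+ a j).
  apply: (adjoin_pow_monomial h0) hu; first exact: enum_uniq.
  by apply: permutably_regular_family; rewrite ?enum_uniq // -cardE Ac.
apply: prime_notM => //; apply: prime_not_prod => // i; rewrite inE => iA.
by apply: prime_notX => //; apply: hA.
Qed.

End StarConfiguration.

(** * Normal forms and the minimal exponent sum *)

Section NormalForm.
Set Implicit Arguments.
Unset Strict Implicit.
Variables (s c : nat).
Implicit Types (A B : {set 'I_s}) (L : seq {set 'I_s}).

Definition exponent L (j : 'I_s) := count (fun A => j \in A) L.

Lemma prod_supports (R : comNzRingType) (F : 'I_s -> R) L :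
  \prod_(A <- L) \prod_(j in A) F j = \prod_j F j ^+ exponent L j.
Proof.
elim: L => [|A L IH]; first by rewrite big_nil big1.
rewrite big_cons IH big_mkcond -big_split; apply: eq_bigr => j _ /=.
by rewrite exprD; case: (j \in A).
Qed.

Lemma sum_exponents L B :
  (\sum_(j in B) exponent L j = \sum_(A <- L) #|A :&: B|)%N.
Proof.
elim: L => [|A L IH]; first by rewrite big_nil big1.
rewrite big_cons -IH /exponent /= big_split /=; congr (_ + _)%N.
rewrite -sum1_card -big_mkcondr; apply: eq_bigl => j.
by rewrite inE andbC.
Qed.

(** Inclusion-exclusion: A :|: B has at most s elements. *)
Lemma sum_defects_le L B : #|B| = c ->
  (\sum_(A <- L) (c + #|A| - s) <= \sum_(j in B) exponent L j)%N.
Proof.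
move=> Bc; rewrite sum_exponents; apply: leq_sum => A _.
have := cardsUI A B; have := subset_leq_card (finset.subsetT (A :|: B)).
by rewrite cardsT card_ord Bc; lia.
Qed.

Definition descending L := forall i, (i.+1 < size L)%N ->
  nth finset.set0 L i.+1 \subset nth finset.set0 L i.

Lemma descending_total L A B : descending L -> A \in L -> B \in L ->
  A \subset B \/ B \subset A.
Proof.
move=> /(@sortedP _ (fun A B => B \subset A)) hL AL BL.
have tr : transitive (fun A B => B \subset A).
  by move=> Y X Z h1 h2; apply: (fintype.subset_trans h2 h1).
have rf : reflexive (fun A B => B \subset A) by move=> X; apply: subxx.
have h := sorted_leq_nth tr rf finset.set0 hL.
rewrite -(nth_index finset.set0 AL) -(nth_index finset.set0 BL).
have [le|/ltnW le] := leqP (index A L) (index B L); [right|left];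
  by apply: h => //; rewrite inE index_mem.
Qed.

(** Take B with c elements and the least exponent sum. If a support A meets B
    without covering the complement of B, exchange some j in A and B for some
    i outside both. As the supports form a chain, i lies in fewer of them
    than j, so the exponent sum decreases. Hence every support is disjoint
    from B or covers its complement, and both cases give equality. *)
Lemma sum_defects_attained L : (c <= s)%N -> descending L ->
  exists2 B : {set 'I_s}, #|B| = c &
    (\sum_(j in B) exponent L j = \sum_(A <- L) (c + #|A| - s))%N.
Proof.
move=> cs hL; have [B0 hB0] : exists B : {set 'I_s}, #|B| == c.
  have : (0 < #|[set B : {set 'I_s} | #|B| == c]%SET|)%N.
    by rewrite card_draws card_ord bin_gt0.
  by case/card_gt0P => B; rewrite inE; exists B.
case: (@arg_minnP _ B0 (fun B : {set 'I_s} => #|B| == c)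
  (fun B => \sum_(j in B) exponent L j)%N hB0) => B /eqP Bc Bmin.
exists B => //; rewrite sum_exponents; apply: eq_big_seq => A AL.
suff : A :&: B = finset.set0 \/ A :|: B = [set: 'I_s]%SET.
  have := cardsUI A B; have := subset_leq_card (finset.subsetT (A :|: B)).
  rewrite cardsT card_ord Bc => h1 h2 [] e; move: h1 h2;
    by rewrite e ?cards0 ?cardsT ?card_ord; lia.
have [->|/set0Pn[j]] := eqVneq (A :&: B) finset.set0; first by left.
rewrite inE => /andP[jA jB]; right; apply/setP => i; rewrite !inE.
apply: contraT; rewrite negb_or => /andP[iA iB].
have lt_ij : (exponent L i < exponent L j)%N.
  rewrite /exponent -!sum1_count big_mkcond [X in (_ < X)%N]big_mkcond /=.
  rewrite !(big_rem A AL) /= jA (negPf iA) add0n add1n ltnS.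
  rewrite [X in (X <= _)%N]big_seq [X in (_ <= X)%N]big_seq.
  apply: leq_sum => X /mem_rem XL; case: ifP => // iX; case: ifP => // /negP[].
  case: (descending_total hL AL XL) => /fintype.subsetP; first exact.
  by move=> h; rewrite h in iA.
have := Bmin (i |: (B :\ j)).
rewrite cardsU1 !inE (negPf iB) andbF /= -Bc (cardsD1 j) jB eqxx => /(_ isT).
rewrite big_setU1 ?inE ?(negPf iB) ?andbF //= (big_setD1 j jB) /=.
by rewrite leq_add2r leqNgt lt_ij.
Qed.

(** The l-th support (from 0) consists of the indices whose exponent
    exceeds l. *)
Lemma normal_form_exists (R : idomainType) (F : 'I_s -> R) M :
  monomial_in F M -> exists L, normal_form F M L.
Proof.
move=> [J ->]; pose m := (\max_j count_mem j J)%N.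
pose S l : {set 'I_s} := [set j | (l < count_mem j J)%N]%SET.
exists [seq S l | l <- iota 0 m]; split.
- move=> _ /mapP[l + ->]; rewrite mem_iota add0n => /= lm.
  apply/set0Pn; apply: contraTP lm => /forallNP h; rewrite -leqNgt.
  apply/bigmax_leqP => j _; rewrite leqNgt; apply/negP => lj.
  by apply: (h j); rewrite inE.
- move=> l; rewrite size_map size_iota => lm.
  rewrite !(nth_map 0%N) ?size_iota ?(ltnW lm) // !nth_iota ?(ltnW lm) // !add0n.
  by apply/fintype.subsetP => j; rewrite !inE; apply: ltnW.
rewrite prod_supports.
have -> : \prod_(j <- J) F j = \prod_j F j ^+ count_mem j J.
  elim: J {m S} => [|x J IH]; first by rewrite big_nil big1.
  rewrite big_cons IH (bigD1 x) //= [RHS](bigD1 x) //= eqxx exprS -mulrA.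
  congr (_ * (_ * _)); apply: eq_bigr => j /negPf; rewrite eq_sym => -> //.
apply: eq_bigr => j _; congr (_ ^+ _).
rewrite /exponent count_map -[RHS]size_filter.
rewrite -[LHS](size_iota 0) -(@filter_iota_ltn 0 m) ?leq_bigmax //.
by congr size; apply: eq_filter => l; rewrite /= inE.
Qed.

End NormalForm.

(** The exponents of the monomial are read off from the normal form that
    [Sdeg] selects. *)
Lemma mem_symbolic_star (R : idomainType) (s c : nat) (F : 'I_s -> R)
    (M : R) (u : nat) :
  noetherian R -> (c < s)%N ->
  (forall J : seq 'I_s, uniq J -> size J = c.+1 ->
     regular_sequence [seq F j | j <- J]) ->
  monomial_in F M ->
  symbolic_pow (star_ideal F c) u M <-> (u <= Sdeg F c M)%N.
Proof.
move=> hR cs F_reg /normal_form_exists[L0 hL0].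
rewrite /Sdeg; case: xgetP => [L _ hL|/(_ L0)//].
case: hL => _ desc ->; rewrite prod_supports.
case: u => [//|u]; split=> [hM|hu P hP].
  have [B Bc <-] := sum_defects_attained (ltnW cs) desc.
  have [P [hP BP hB]] := exists_associated_star cs F_reg hR Bc.
  apply: (loc_contraction_monomial cs F_reg _ Bc BP hB); first by case: hP.
  exact: hM.
have [A [Ac hA]] := associated_star cs F_reg hP.
apply: (monomial_loc_contraction _ Ac hA); first by case: hP.
exact: leq_trans hu (sum_defects_le L Ac).
Qed.

(** * The symbolic degree of a monomial *)

Theorem theorem4p7 (k : fieldType) (n c s : nat)
    (c_ge1 : (1 <= c)%N) (c_lt_s : (c < s)%N)
    (F : 'I_s -> {mpoly k[n.+1]})
    (F_inj : injective F)
    (F_form : forall i, exists d, F i \is d.-homog)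
    (F_reg : forall J : seq 'I_s, uniq J -> size J = c.+1 ->
       regular_sequence [seq F j | j <- J])
    (M : {mpoly k[n.+1]}) (hM : monomial_in F M) :
  is_max (fun u => symbolic_pow (star_ideal F c) u M) (Sdeg F c M) /\
  unique (fun m => symbolic_pow (star_ideal F c) m M /\
                   ~ symbolic_pow (star_ideal F c) m.+1 M) (Sdeg F c M).
Proof.
have mem u := mem_symbolic_star u (@mpoly_noetherian n.+1 k) c_lt_s F_reg hM.
split; split.
- exact/mem.
- by move=> u /mem.
- by split; [exact/mem|move=> /mem; rewrite ltnn].
move=> m [/mem le_m nm]; apply/eqP; rewrite eqn_leq le_m andbT leqNgt.
by apply/negP => lt_m; apply: nm; apply/mem.
Qed.
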